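(* $\lim_{n \to \infty} c(L_{n,n}) \ge \alpha^2 \approx 1.35103$, where $\alpha$ is the largest real solution to $x = \tan\left(\frac{1}{x}\right)$.
   Context: For a positive integer $h$ and a finite simple graph $G$ with $n$ vertices and $k$ connected components, fix one vertex in each connected component of $G$, and let $\mathrm{Lip}(G;h)$ be the set of functions $f: V(G) \to \mathbb{Z}$ such that $f$ takes the value $0$ at each of the fixed vertices and $|f(x)-f(y)| \le h$ for every edge $\{x,y\} \in E(G)$. The cardinality $|\mathrm{Lip}(G;h)|$ does not depend on the choice of fixed vertices. If $k < n$, define $c(G) = \lim_{h\to\infty} \frac{1}{h}\,|\mathrm{Lip}(G;h)|^{1/(n-k)}$ (limit over positive integers $h$; this limit exists). $L_{m,n}$ denotes the $m \times n$ grid graph, i.e. the graph Cartesian product of a path on $m$ vertices and a path on $n$ vertices. *)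

(* Defs.v *)
From HB Require Import structures.
From mathcomp Require Import all_boot all_order all_algebra finmap.
From mathcomp Require Import all_classical all_reals all_analysis.

Set Implicit Arguments.
Unset Strict Implicit.
Unset Printing Implicit Defensive.

Import Order.TTheory GRing.Theory Num.Theory.
Import numFieldNormedType.Exports.

Local Open Scope classical_set_scope.
Local Open Scope ring_scope.

Record sgraph := SGraph {
  vertex :> finType;
  adj : rel vertex;
  adj_sym : symmetric adj;
  adj_irr : irreflexive adj }.

Section Paths.
Variable n : nat.

Definition path_adj : rel 'I_n :=
  fun i j => (i.+1 == j :> nat) || (j.+1 == i :> nat).

Lemma path_adj_sym : symmetric path_adj.
Proof. by move=> i j; rewrite /path_adj orbC. Qed.

Lemma path_adj_irr : irreflexive path_adj.
Proof. by move=> i; rewrite /path_adj orbb gtn_eqF. Qed.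

Definition path_graph := SGraph path_adj_sym path_adj_irr.
End Paths.

Section CartesianProduct.
Variables G H : sgraph.

Definition cart_adj : rel (G * H)%type :=
  fun x y =>
  (x.1 == y.1) && adj x.2 y.2 || (x.2 == y.2) && adj x.1 y.1.

Lemma cart_adj_sym : symmetric cart_adj.
Proof.
move=> x y; rewrite /cart_adj [x.1 == _]eq_sym [x.2 == _]eq_sym.
by rewrite (adj_sym x.1) (adj_sym x.2).
Qed.

Lemma cart_adj_irr : irreflexive cart_adj.
Proof. by move=> x; rewrite /cart_adj !adj_irr !andbF. Qed.

Definition cart_graph := SGraph cart_adj_sym cart_adj_irr.
End CartesianProduct.

Definition grid (m n : nat) : sgraph := cart_graph (path_graph m) (path_graph n).

Section Lipschitz.
Variable G : sgraph.

Definition component_reps (S : {set G}) : Prop :=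
  forall x : G, exists! s : G, s \in S /\ connect (@adj G) x s.

Definition Lip (S : {set G}) (h : nat) : set {ffun G -> int} :=
  [set f : {ffun G -> int} | (forall s, s \in S -> f s = 0) /\
           (forall x y, adj x y -> `|f x - f y| <= h%:Z)].

Definition base_reps : {set G} := [set x | fingraph.roots (@adj G) x]%SET.

(* [fset_set] is empty on infinite sets; see [finite_Lip]. The choice of
   representatives is immaterial; see [card_Lip_indep]. *)
Definition card_Lip (S : {set G}) (h : nat) : nat := #|` fset_set (Lip S h)|.

Let csym : connect_sym (@adj G).
Proof. by apply: sym_connect_sym; exact: adj_sym. Qed.

Lemma base_repsP : component_reps base_reps.
Proof.
move=> x; exists (fingraph.root (@adj G) x); split.
  by rewrite inE roots_root // connect_root.
move=> s []; rewrite inE => /eqP sE xs; rewrite -[RHS]sE.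
exact/(fingraph.rootP csym).
Qed.

Lemma finite_Lip (S : {set G}) (h : nat) :
  component_reps S -> finite_set (Lip S h).
Proof.
move=> HS; pose N := (h * #|G|)%N.
apply: (@sub_finite_set _ _ [set [ffun x => (g x : nat)%:Z - N%:Z] |
    g in [set: {ffun G -> 'I_(N + N).+1}]]); last first.
  by apply: finite_image; exact: finite_finset.
move=> f [f0 fh].
have fN x : `|f x| <= N%:Z.
  have [s [[sS xs] _]] := HS x.
  have: connect (@adj G) s x by rewrite csym.
  case/connectP => p pp ->; case/shortenP: pp => q qp uq _.
  have sz : (size q <= #|G|)%N.
    by rewrite -(card_uniqP (andP uq).2) max_card.
  apply: le_trans (_ : (h * size q)%N%:Z <= _); last first.
    by rewrite lez_nat leq_mul2l sz orbT.
  have fs : f s = 0 by exact: f0.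
  have: `|f s| <= 0 by rewrite fs normr0.
  have -> : (h * size q)%N%:Z = 0 + (h * size q)%N%:Z by rewrite add0r.
  move: (0 : int) => b; clear xs uq sz fs sS; elim: q s b qp => [|y q IH] s b /=.
    by rewrite muln0 addr0.
  case/andP => sy yq sb.
  rewrite mulnS PoszD addrA; apply: IH => //.
  have -> : f y = f s - (f s - f y) by rewrite opprB addrC subrK.
  by apply: le_trans (ler_normB _ _) _; apply: lerD => //; exact: fh.
exists [ffun x => inord (absz (f x + N%:Z))] => //.
apply/ffunP => x; rewrite !ffunE.
have := fN x; rewrite ler_norml => /andP [l u].
have p : 0 <= f x + N%:Z by rewrite -[0](addNr N%:Z) lerD2r.
rewrite inordK ?gez0_abs ?addrK // ltnS -lez_nat gez0_abs //.
by rewrite PoszD lerD2r.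
Qed.

Lemma card_Lip_indep (S T : {set G}) (h : nat) :
  component_reps S -> component_reps T -> card_Lip S h = card_Lip T h.
Proof.
have shift (A B : {set G}) : component_reps A -> component_reps B ->
    (card_Lip A h <= card_Lip B h)%N; last first.
  by move=> HS HT; apply/eqP; rewrite eqn_leq !shift.
move=> HA HB.
have /choice[b bP] : forall x : G, exists s : G,
    s \in B /\ connect (@adj G) x s.
  by move=> x; have [s [? _]] := HB x; exists s.
have bE x y : connect (@adj G) x y -> b x = b y.
  move=> xy; have [s [_ sU]] := HB x; have [bB bc] := bP y.
  by rewrite -(sU _ (bP x)); apply: sU; split => //; exact: connect_trans bc.
pose F (f : {ffun G -> int}) : {ffun G -> int} := [ffun x => f x - f (b x)].
have FL f : Lip A h f -> Lip B h (F f).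
  move=> [fA fh]; split => [s sB|x y xy].
    have [u [_ uU]] := HB s.
    have bs : b s = s.
      by rewrite -(uU _ (bP s)); apply: uU; split => //; exact: connect0.
    by rewrite ffunE bs subrr.
  rewrite !ffunE (bE x y) ?connect1 // opprB addrA subrK.
  exact: fh.
have FI : {in fset_set (Lip A h) &, injective F}.
  move=> f g; rewrite !in_fset_set; do 2?exact: finite_Lip.
  rewrite !inE => -[fA _] [gA _] /ffunP fg; apply/ffunP => x.
  have [s [[sA xs] _]] := HA x.
  have := fg x; have := fg s; rewrite !ffunE (bE x s) // fA // gA // !sub0r.
  by move=> /oppr_inj ->; apply: addIr.
rewrite /card_Lip -[X in (X <= _)%N](card_in_imfset imfset_key FI) /=.
apply: fsubset_leq_card; apply/fsubsetP => g /imfsetP[f /= fL ->].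
move: fL; rewrite !in_fset_set ?inE; try exact: finite_Lip.
exact: FL.
Qed.

(* Meaningful when [G] has at least one edge, i.e. when the subtraction below
   is positive. The term of index [h = 0] does not affect the limit. *)
Definition lip_const (R : realType) : R :=
  limn (fun h : nat =>
    h%:R^-1 * (card_Lip base_reps h)%:R
      `^ ((#|G| - n_comp (@adj G) predT)%N%:R)^-1).
End Lipschitz.

(* Division by [0] and [tan] at the zeros of [cos] are total in the library,
   hence the two side conditions. *)
Definition tan_inv_sol (R : realType) (x : R) : Prop :=
  [/\ x != 0, cos x^-1 != 0 & x = tan x^-1].

Definition largest_tan_inv_sol (R : realType) (a : R) : Prop :=
  tan_inv_sol a /\ forall x : R, tan_inv_sol x -> x <= a.

(* Main.v *)
(** Put [A_h(m, n)] for the number of [h]-Lipschitz functions on the [m] by [n]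
    grid, pinned at one vertex.

    Dividing by [k] and rounding down maps [Lip (h k)] to [Lip h], at most
    [k ^ d] to one, [d] being the number of vertices minus one. Hence
    [A_h ^ (1 / d) / h] is almost monotone in [h] and converges. Cutting a grid
    along an edge shows that [(2 h + 1) A_h(m, n)] is submultiplicative in [m]
    and in [n]; letting [h] tend to infinity gives, in the same way, the
    convergence of [c(L_{n,n})].

    For the lower bound, Cauchy-Schwarz over the values on the middle row gives
    [A_h(j + 1, n) ^ 2 <= A_h(1, n) A_h(2 j + 1, n)], so that the two-row grid
    controls all grids with [2 ^ k + 1] rows. The two-row grid is computed
    column by column with the kernel [2 h + 1 - |u - w|] on [[-h, h]], where [u]
    and [w] are the increments along consecutive rungs. When
    [theta tan theta = 1], the vector [cos (theta u / h)] is a subsolution of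
    its eigenvalue equation for the eigenvalue [2 h ^ 2 / theta ^ 2], and
    [alpha = 1 / theta]. *)

Require Import Defs.
From mathcomp Require Import all_boot all_order all_algebra finmap.
From mathcomp Require Import all_classical all_reals all_analysis.
From mathcomp Require Import zify ring lra.

Import Order.TTheory GRing.Theory Num.Theory.
Import numFieldNormedType.Exports.

Local Open Scope classical_set_scope.
Local Open Scope ring_scope.

(** * Counting in finite sets *)

Lemma leq_fset_set_inj (T U : choiceType) (A : set T) (B : set U) (F : T -> U) :
  finite_set B -> (forall x, A x -> B (F x)) ->
  (forall x y, A x -> A y -> F x = F y -> x = y) ->
  (#|` fset_set A| <= #|` fset_set B|)%N.
Proof.
move=> finB AB injF.
(* On an infinite set [fset_set] defaults to the empty set, so that case is trivial. *)
have [finA|infA] := pselect (finite_set A); last first.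
  by rewrite /fset_set; case: pselect => // ?; rewrite cardfs0.
have FI : {in fset_set A &, injective F}.
  by move=> x y; rewrite !in_fset_set // !inE => ? ?; exact: injF.
rewrite -[X in (X <= _)%N](card_in_imfset imfset_key FI) /=.
apply: fsubset_leq_card; apply/fsubsetP => g /imfsetP[f /= fL ->].
move: fL; rewrite !in_fset_set // !inE; exact: AB.
Qed.

(** The joint injectivity of [F] embeds the disjoint union of the [A i] into [B]. *)
Lemma leq_sum_fset_set (I : finType) (T U : choiceType) (A : I -> set T)
    (B : set U) (F : I -> T -> U) :
  (forall i, finite_set (A i)) -> finite_set B ->
  (forall i x, A i x -> B (F i x)) ->
  (forall i j x y, A i x -> A j y -> F i x = F j y -> i = j /\ x = y) ->
  (\sum_i #|` fset_set (A i)| <= #|` fset_set B|)%N.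
Proof.
move=> finA finB AB inj.
pose T_ (i : I) : finType := fset_set (A i).
have -> : (\sum_i #|` fset_set (A i)| = #|{: {i : I & T_ i}}|)%N.
  rewrite card_tagged sumnE big_map big_enum /=.
  by apply: eq_bigr => i _; rewrite cardfE.
have memA i (x : fset_set (A i)) : A i (val x).
  by have := valP x; rewrite in_fset_set // inE.
have memB (u : {i : I & T_ i}) : F (tag u) (val (tagged u)) \in fset_set B.
  by rewrite in_fset_set // inE; exact/AB/memA.
pose G u : (fset_set B : finType) := [` memB u]%fset.
rewrite [X in (_ <= X)%N]cardfE; apply: (@leq_card _ _ G).
move=> [i x] [j y] /(congr1 val) /= /inj []; [exact: memA|exact: memA|].
move=> ij; case: _ / ij y => y xy; congr Tagged; exact: val_inj.
Qed.

(** Cauchy-Schwarz against the constant 1. After doubling, the bound [2 a b <= a ^ 2 + b ^ 2]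
    applies term by term. *)
Lemma sum_sqr_leq (I : finType) (F : I -> nat) :
  ((\sum_i F i) ^ 2 <= #|I| * \sum_i F i ^ 2)%N.
Proof.
rewrite -(@leq_pmul2l 2) // -mulnn big_distrl big_distrr /=.
under eq_bigr do rewrite big_distrr big_distrr /=.
apply: (@leq_trans (\sum_i \sum_j (F i ^ 2 + F j ^ 2)))%N.
  by apply: leq_sum => i _; apply: leq_sum => j _; exact: nat_Cauchy.
under eq_bigr do rewrite big_split sum_nat_const /=.
by rewrite big_split /= -big_distrr sum_nat_const /= addnn mul2n.
Qed.

(** Cauchy-Schwarz over the fibres of [p]: the squares of the fibre sizes count the pairs inside a
    common fibre, and [F] embeds these pairs into [C]. *)
Lemma sqr_fset_set_leq (T U V : choiceType) (A : set T) (B : set U) (C : set V)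
    (p : T -> U) (F : T -> T -> V) :
  finite_set A -> finite_set B -> finite_set C ->
  (forall x, A x -> B (p x)) ->
  (forall x y, A x -> A y -> p x = p y -> C (F x y)) ->
  (forall x y x' y', A x -> A y -> A x' -> A y' -> p x = p y -> p x' = p y' ->
     F x y = F x' y' -> x = x' /\ y = y') ->
  (#|` fset_set A| ^ 2 <= #|` fset_set B| * #|` fset_set C|)%N.
Proof.
move=> finA finB finC AB AC inj.
pose I : finType := fset_set B.
pose Ai (b : I) := A `&` [set x | p x = val b].
have finAi b : finite_set (Ai b) by exact: finite_setIl.
pose P := fun b : I => [set z : T * T | Ai b z.1 /\ Ai b z.2].
have finP b : finite_set (P b) by exact: finite_setX.
have cardP b : (#|` fset_set (Ai b)| ^ 2 <= #|` fset_set (P b)|)%N.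
  rewrite !cardfE -mulnn -card_prod.
  have memP (u : fset_set (Ai b) * fset_set (Ai b)) :
      (val u.1, val u.2) \in fset_set (P b).
    have := valP u.1; have := valP u.2; rewrite !in_fset_set // !inE.
    by move=> ? ?; split.
  apply: (@leq_card _ _ (fun u => [` memP u]%fset)) => -[u1 u2] [v1 v2].
  by move=> /(congr1 val) [] /val_inj -> /val_inj ->.
have -> : #|` fset_set A| = (\sum_(b : I) #|` fset_set (Ai b)|)%N.
  apply/eqP; rewrite eqn_leq; apply/andP; split; last first.
    apply: (@leq_sum_fset_set _ _ _ _ _ (fun _ => id)) => //.
      by move=> i x [].
    move=> i j x y [_ /= xi] [_ /= yj] xy; split => //; apply: val_inj.
    by rewrite /= -xi -yj xy.
  have pI x : A x -> p x \in fset_set B by rewrite in_fset_set // inE;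
    exact: AB.
  rewrite cardfE -sum1_card.
  have memA (x : fset_set A) : A (val x).
    by have := valP x; rewrite in_fset_set // inE.
  pose q (x : fset_set A) : I := [` pI _ (memA x)]%fset.
  rewrite (partition_big q predT) //=; apply: leq_sum => b _.
  rewrite sum1_card [X in (_ <= X)%N]cardfE.
  have mA (x : fset_set A) : q x == b -> val x \in fset_set (Ai b).
    move=> /eqP <-; rewrite in_fset_set // inE; split => //; exact: memA.
  rewrite -[X in (X <= _)%N]card_sig.
  pose g (u : {x : fset_set A | q x == b}) : fset_set (Ai b) :=
     [` mA (val u) (valP u)]%fset.
  apply: (@leq_card _ _ g) => u v /(congr1 val) /= uv.
  by do 2!apply: val_inj.
apply: leq_trans (sum_sqr_leq _ _) _.
rewrite [X in (_ <= X * _)%N]cardfE leq_mul2l; apply/orP; right.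
apply: (@leq_trans (\sum_(b : I) #|` fset_set (P b)|)%N).
  by apply: leq_sum => b _; exact: cardP.
apply: (@leq_sum_fset_set _ _ _ _ _ (fun _ z => F z.1 z.2)) => //.
  by move=> b [x y] [[Ax xb] [Ay yb]]; apply: AC => //; rewrite xb.
move=> b c [x y] [x' y'] [/= [Ax xb] [Ay yb]] [[Ax' xb'] [Ay' yb']] e.
have [||xx yy] := inj _ _ _ _ Ax Ay Ax' Ay' _ _ e; rewrite ?xb ?xb' //.
by rewrite xx yy; split => //; apply: val_inj; rewrite /= -xb -xb' xx.
Qed.

(** * Lipschitz functions on connected graphs *)

Definition gconnected (G : sgraph) := forall x y : G, connect (@adj G) x y.

Lemma component_reps1 (G : sgraph) (s : G) :
  gconnected G -> component_reps [set s]%SET.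
Proof.
move=> cG x; exists s; split; first by rewrite inE eqxx; split.
by move=> t []; rewrite inE => /eqP.
Qed.

Lemma card_Lip_base (G : sgraph) (s : G) (h : nat) : gconnected G ->
  card_Lip (base_reps G) h = card_Lip [set s]%SET h.
Proof.
move=> cG; apply: card_Lip_indep; first exact: base_repsP.
exact: component_reps1.
Qed.

Lemma n_comp_connected (G : sgraph) (s : G) : gconnected G ->
  n_comp (@adj G) predT = 1%N.
Proof.
move=> cG.
have sG : connect_sym (@adj G) by apply: sym_connect_sym; exact: adj_sym.
rewrite -(n_comp_connect sG s); apply: eq_n_comp_r => x.
by rewrite !inE cG.
Qed.

Section ConnectedGraph.
Variables (G : sgraph) (s : G).
Hypothesis cG : gconnected G.

Let finL h : finite_set (Lip [set s]%SET h).
Proof. exact/finite_Lip/component_reps1. Qed.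

Lemma mem_Lip1 (h : nat) (f : {ffun G -> int}) :
  f \in fset_set (Lip [set s]%SET h) <->
  f s = 0 /\ forall x y, adj x y -> `|f x - f y| <= h%:Z.
Proof.
rewrite in_fset_set // inE; split=> -[fs fh]; split => //.
  by apply: fs; rewrite inE.
by move=> t; rewrite inE => /eqP ->.
Qed.

Lemma leq_card_Lip (h k : nat) : (h <= k)%N ->
  (card_Lip [set s]%SET h <= card_Lip [set s]%SET k)%N.
Proof.
move=> hk; apply: fsubset_leq_card; apply/fsubsetP => f.
rewrite !mem_Lip1 => -[fs fh]; split => // x y xy.
by apply: le_trans (fh _ _ xy) _; rewrite lez_nat.
Qed.

Let card_nonbase : #|{: {x : G | x != s}}| = #|G|.-1.
Proof. by rewrite card_sig -(cardC1 s); apply: eq_card => x; rewrite !inE. Qed.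

(* An element of [Lip (h * k)] is determined by its quotient by [k], which is
   in [Lip h], and by its remainders. *)
Lemma card_Lip_dilate (h k : nat) : (0 < k)%N ->
  (card_Lip [set s]%SET (h * k) <= k ^ #|G|.-1 * card_Lip [set s]%SET h)%N.
Proof.
move=> k0; pose Q (f : {ffun G -> int}) : {ffun G -> int} :=
  [ffun x => (f x %/ k%:Z)%Z].
have kz : k%:Z != 0 by rewrite eqz_nat -lt0n.
have modk z : exists r : 'I_k, (z %% k%:Z)%Z = r%:Z.
  have rk : (`|(z %% k%:Z)%Z| < k)%N.
    by rewrite -ltz_nat gez0_abs ?modz_ge0 // ltz_pmod.
  by exists (Ordinal rk); rewrite /= gez0_abs ?modz_ge0.
have /choice[r rE] := modk.
have QL (f : fset_set (Lip [set s]%SET (h * k))) :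
    Q (val f) \in fset_set (Lip [set s]%SET h).
  have /mem_Lip1[fs fh] := valP f; apply/mem_Lip1; split.
    by rewrite ffunE fs div0z.
  (* Rounding down commutes with adding [h * k], so [f x <= f y + h * k] yields the bound [h] on the
     quotients. *)
  move=> x y /fh; rewrite !ffunE.
  have := rE (val f x); have := rE (val f y).
  have := ltn_ord (r (val f x)); have := ltn_ord (r (val f y)).
  have := divz_eq (val f x) k; have := divz_eq (val f y) k.
  by nia.
rewrite /card_Lip !cardfE -card_nonbase -[k in (k ^ _)%N]card_ord -card_ffun.
rewrite -card_prod.
pose F (f : fset_set (Lip [set s]%SET (h * k))) :=
  ([ffun u : {x : G | x != s} => r (val f (val u))], [` QL f]%fset).
apply: (@leq_card _ _ F).
move=> f g [] /ffunP rfg /ffunP qfg; apply: val_inj; apply/ffunP => x.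
have /mem_Lip1[fs _] := valP f; have /mem_Lip1[gs _] := valP g.
have [->|xs] := eqVneq x s; first by rewrite fs gs.
rewrite (divz_eq (val f x) k) (divz_eq (val g x) k) !rE.
have := qfg x; rewrite !ffunE => ->.
by have := rfg (Sub x xs); rewrite !ffunE /= => ->.
Qed.

(** Values chosen freely in [[0, h)] away from [s] differ by at most [h], whatever the edges are.
    This gives the lower bound 1 for [lip_const]. *)
Lemma card_Lip_ge (h : nat) : (h ^ #|G|.-1 <= card_Lip [set s]%SET h)%N.
Proof.
rewrite /card_Lip !cardfE -card_nonbase -[h in (h ^ _)%N]card_ord -card_ffun.
pose F (g : {ffun {x : G | x != s} -> 'I_h}) : {ffun G -> int} :=
  [ffun x => if insub x is Some u then (g u)%:Z else 0].
have FL g : F g \in fset_set (Lip [set s]%SET h).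
  apply/mem_Lip1; split; first by rewrite ffunE insubN // eqxx.
  move=> x y _; rewrite !ffunE.
  by case: insubP => [u _ _|_]; case: insubP => [v _ _|_]; 
    try (have := ltn_ord (g u)); try (have := ltn_ord (g v)); lia.
apply: (@leq_card _ _ (fun g => [` FL g]%fset)) => f g /(congr1 val) /ffunP e.
apply/ffunP => u; have := e (val u); rewrite !ffunE valK => -[] ?.
exact: val_inj.
Qed.

Lemma card_Lip_gt0 (h : nat) : (0 < card_Lip [set s]%SET h)%N.
Proof.
rewrite cardfs_gt0; apply/fset0Pn; exists [ffun=> 0]; apply/mem_Lip1.
by rewrite ffunE; split => // x y _; rewrite !ffunE.
Qed.

End ConnectedGraph.

(* A function on [G] is determined, up to translation, by its restrictions to
   the images of [G1] and [G2] and by its increment along one edge joining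
   them. *)
Lemma card_Lip_cover (G1 G2 G : sgraph) (i1 : G1 -> G) (i2 : G2 -> G)
    (s1 : G1) (s2 : G2) (h : nat) :
  gconnected G1 -> gconnected G2 -> gconnected G ->
  {homo i1 : x y / adj x y} -> {homo i2 : x y / adj x y} ->
  (forall x, (exists y, x = i1 y) \/ (exists y, x = i2 y)) ->
  adj (i1 s1) (i2 s2) ->
  (card_Lip [set i1 s1]%SET h <=
   (2 * h).+1 * (card_Lip [set s1]%SET h * card_Lip [set s2]%SET h))%N.
Proof.
move=> c1 c2 cG h1 h2 cov e12; rewrite /card_Lip !cardfE.
rewrite -[(2 * h).+1]card_ord -!card_prod.
set L := fset_set (Lip [set i1 s1]%SET h).
pose R (H : sgraph) (i : H -> G) (t : H) (f : {ffun G -> int}) :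
  {ffun H -> int} := [ffun x => f (i x) - f (i t)].
have RL H (cH : gconnected H) (i : H -> G) t (f : L) :
    {homo i : x y / adj x y} -> R H i t (val f) \in fset_set (Lip [set t]%SET
      h).
  move=> hi; have /mem_Lip1-/(_ cG)[fs fh] := valP f; apply/mem_Lip1 => //.
  rewrite ffunE subrr; split => // x y xy; rewrite !ffunE.
  by rewrite opprB addrA subrK; exact/fh/hi.
have dL (f : L) : (absz (val f (i2 s2) + h%:Z)%R < (2 * h).+1)%N.
  have /mem_Lip1-/(_ cG)[fs fh] := valP f.
  have := fh _ _ e12; rewrite fs.
  by move: (val f (i2 s2)) => z; lia.
apply: (@leq_card _ _ (fun f : L => (Ordinal (dL f),
   ([` RL _ c1 i1 s1 f h1]%fset, [` RL _ c2 i2 s2 f h2]%fset)))).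
move=> f g [] df /ffunP f1 /ffunP f2; apply: val_inj; apply/ffunP => x.
have /mem_Lip1-/(_ cG)[fs fh] := valP f.
have /mem_Lip1-/(_ cG)[gs gh] := valP g.
have e : val f (i2 s2) = val g (i2 s2).
  have := fh _ _ e12; have := gh _ _ e12; rewrite fs gs; move: df.
  by move: (val f (i2 s2)) (val g (i2 s2)) => z w; lia.
have [[y ->]|[y ->]] := cov x.
  by have := f1 y; rewrite !ffunE fs gs !subr0.
by have := f2 y; rewrite !ffunE e => /addIr.
Qed.

(** * Grids *)

Lemma path_connected (n : nat) : gconnected (path_graph n).
Proof.
have sP : connect_sym (@path_adj n).
  by apply: sym_connect_sym; exact: path_adj_sym.
suff up (i j : 'I_n) : (i <= j)%N -> connect (@path_adj n) i j.
  move=> i j; have [/up//|/ltnW/up] := leqP i j; by rewrite sP.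
case: j => j jn /=; elim: j jn => [|j IH] jn.
  by rewrite leqn0 => /eqP i0; rewrite (_ : i = Ordinal jn) ?connect0 //;
    exact: val_inj.
rewrite leq_eqVlt => /orP[/eqP ij|ij].
  by rewrite (_ : i = Ordinal jn) ?connect0 //; exact: val_inj.
apply: connect_trans (IH (ltnW jn) ij) (connect1 _).
by rewrite /path_adj /= eqxx.
Qed.

Lemma cart_connected (G H : sgraph) :
  gconnected G -> gconnected H -> gconnected (cart_graph G H).
Proof.
move=> cG cH [x1 x2] [y1 y2].
have homo (K : sgraph) (i : K -> cart_graph G H) (x y : K) :
    {homo i : x y / adj x y} -> connect (@adj K) x y ->
    connect (@adj (cart_graph G H)) (i x) (i y).
  move=> hi /connectP[p pp ->] {y}; elim: p x pp => [|z p IH] x /=.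
    by rewrite connect0.
  move=> /andP[xz /IH]; apply: connect_trans; exact/connect1/hi.
apply: (@connect_trans _ _ (y1, x2)).
  apply: (homo G (fun z => (z, x2))); last exact: cG.
  by move=> a b ab; rewrite /= /cart_adj /= eqxx ab orbT.
apply: (homo H (fun z => (y1, z))); last exact: cH.
by move=> a b ab; rewrite /= /cart_adj /= eqxx ab.
Qed.

Lemma grid_connected (m n : nat) : gconnected (grid m n).
Proof. by apply: cart_connected; exact: path_connected. Qed.

Lemma card_grid (m n : nat) : #|grid m n| = (m * n)%N.
Proof. by rewrite card_prod !card_ord. Qed.

Definition nLip (m n h : nat) : nat := card_Lip (base_reps (grid m n)) h.

Lemma nLipE (m n h : nat) (s : grid m n) :
  nLip m n h = card_Lip [set s]%SET h.
Proof. exact/card_Lip_base/grid_connected. Qed.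

Lemma nLipC (m n h : nat) : nLip m.+1 n.+1 h = nLip n.+1 m.+1 h.
Proof.
suff le m' n' : (nLip m'.+1 n'.+1 h <= nLip n'.+1 m'.+1 h)%N.
  by apply/eqP; rewrite eqn_leq !le.
rewrite !(nLipE _ _ _ (ord0, ord0)) /card_Lip.
pose F (f : {ffun grid m'.+1 n'.+1 -> int}) : {ffun grid n'.+1 m'.+1 -> int} :=
  [ffun x => f (x.2, x.1)].
apply: (@leq_fset_set_inj _ _ _ _ F).
- exact/finite_Lip/component_reps1/grid_connected.
- move=> f [f0 fh]; split=> [t|x y xy].
    by rewrite inE => /eqP ->; rewrite ffunE f0 // inE.
  rewrite !ffunE; apply: fh; move: xy.
  by rewrite /= /cart_adj /= orbC.
- move=> f g _ _ /ffunP fg; apply/ffunP => -[a b].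
  by have := fg (b, a); rewrite !ffunE.
Qed.

Lemma nLip11 (h : nat) : nLip 1 1 h = 1%N.
Proof.
rewrite (nLipE _ _ _ (ord0, ord0)); apply/eqP; rewrite eqn_leq.
rewrite card_Lip_gt0 ?andbT; last exact: grid_connected.
apply: (@leq_trans #|` [fset [ffun=> 0 : int]]%fset|); last by rewrite cardfs1.
apply: fsubset_leq_card; apply/fsubsetP => f.
rewrite mem_Lip1 => [[f0 _]|]; last exact: grid_connected.
by rewrite inE; apply/eqP/ffunP => -[a b]; rewrite ffunE (ord1 a) (ord1 b).
Qed.

(** * Submultiplicativity in the size of the grid *)

Lemma nLip_add (m1 m2 n h : nat) :
  (nLip (m1.+1 + m2.+1) n.+1 h <=
   (2 * h).+1 * (nLip m1.+1 n.+1 h * nLip m2.+1 n.+1 h))%N.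
Proof.
pose i1 (x : grid m1.+1 n.+1) : grid (m1.+1 + m2.+1) n.+1 :=
  (lshift m2.+1 x.1, x.2).
pose i2 (x : grid m2.+1 n.+1) : grid (m1.+1 + m2.+1) n.+1 :=
  (rshift m1.+1 x.1, x.2).
(* The base points are the two ends of the edge of the first column that joins the blocks. *)
rewrite (nLipE _ _ _ (i1 (ord_max, ord0))).
rewrite (nLipE m1.+1 _ _ (ord_max, ord0)) (nLipE m2.+1 _ _ (ord0, ord0)).
apply: (@card_Lip_cover _ _ _ i1 i2); try exact: grid_connected.
- by move=> [a b] [c d]; rewrite /= /cart_adj /path_adj /= (inj_eq
    (@lshift_inj _ _)).
- move=> [a b] [c d]; rewrite /= /cart_adj /= /path_adj /= (inj_eq
    (@rshift_inj _ _)).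
  by rewrite ?addSn !eqSS -!addnS !eqn_add2l.
- move=> [a b]; case: (splitP a) => c ac; [left|right]; exists (c, b).
    by apply: (congr1 (fun z => (z, b))); apply: val_inj; rewrite /= ac.
  by apply: (congr1 (fun z => (z, b))); apply: val_inj; rewrite /= ac.
- by rewrite /= /cart_adj /= /path_adj /= addn0 !eqxx orbT.
Qed.

Lemma leq_exp2rW (m n e : nat) : (m <= n)%N -> (m ^ e <= n ^ e)%N.
Proof. by case: e => [|e] mn; rewrite ?expn0 ?leq_exp2r. Qed.

(** The factor [2 h + 1] absorbs the increment along the cut edge. The value 1 on an empty grid lets
    [bLipD] hold for an empty block, hence for a zero remainder. *)
Definition bLip (m n h : nat) : nat :=
  if (m * n == 0)%N then 1%N else ((2 * h).+1 * nLip m n h)%N.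

Lemma bLipC (m n h : nat) : bLip m n h = bLip n m h.
Proof.
by case: m n => [|m] [|n]; rewrite /bLip ?muln0 ?mul0n //= nLipC.
Qed.

Lemma bLipD (m1 m2 n h : nat) :
  (bLip (m1 + m2) n h <= bLip m1 n h * bLip m2 n h)%N.
Proof.
case: n => [|n]; first by rewrite /bLip !muln0.
case: m1 => [|m1]; first by rewrite add0n /bLip mul0n mul1n.
case: m2 => [|m2]; first by rewrite addn0 /bLip mul0n muln1.
rewrite /bLip /= (mulnACA _ (nLip _ _ _)) -mulnA leq_mul2l /=.
exact: nLip_add.
Qed.

Lemma bLip_mul (q m n h : nat) : (bLip (q * m) n h <= bLip m n h ^ q)%N.
Proof.
elim: q => [|q IH]; first by rewrite mul0n /bLip mul0n.
by rewrite mulSn expnS; apply: leq_trans (bLipD _ _ _ _) _; rewrite leq_mul.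
Qed.

(** The grid is cut into single vertices, each contributing [2 h + 1]. *)
Lemma bLip_le (m n h : nat) : (bLip m n h <= (2 * h).+1 ^ (m * n))%N.
Proof.
rewrite -[m in bLip m]muln1; apply: leq_trans (bLip_mul _ _ _ _) _.
rewrite [(m * n)%N]mulnC expnM leq_exp2rW // bLipC -[n in bLip n]muln1.
apply: leq_trans (bLip_mul _ _ _ _) _.
by rewrite /bLip /= nLip11 muln1.
Qed.

(** The square is cut into [q ^ 2] blocks of side [n] and an L-shaped border, bounded vertex by
    vertex. *)
Lemma bLip_square (q n r h : nat) :
  (bLip (q * n + r) (q * n + r) h <=
   bLip n n h ^ q ^ 2 * (2 * h).+1 ^ ((q * n + r) ^ 2 - (q * n) ^ 2))%N.
Proof.
set N := (q * n + r)%N.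
have -> : (N ^ 2 - (q * n) ^ 2 = q * n * r + r * N)%N by rewrite /N; lia.
apply: leq_trans (bLipD _ _ _ _) _.
rewrite expnD mulnA leq_mul ?bLip_le //.
rewrite bLipC; apply: leq_trans (bLipD _ _ _ _) _.
rewrite leq_mul //; last by rewrite [(q * n * r)%N]mulnC bLip_le.
apply: leq_trans (bLip_mul _ _ _ _) _.
rewrite -mulnn expnM leq_exp2rW // bLipC.
exact: bLip_mul.
Qed.

(* Two functions on [j + 1] rows with the same last row are glued, the second
   one being reflected, into a function on [2 j + 1] rows. *)
Lemma nLip_reflect (j n h : nat) :
  (nLip j.+1 n.+1 h ^ 2 <= nLip 1 n.+1 h * nLip (j + j).+1 n.+1 h)%N.
Proof.
have jj : (j < (j + j).+1)%N by rewrite ltnS leq_addl.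
rewrite (nLipE j.+1 _ _ (ord_max, ord0)) (nLipE 1 _ _ (ord0, ord0)).
rewrite (nLipE _ _ _ (inord j : 'I_(j + j).+1, ord0 : 'I_n.+1)).
pose p (f : {ffun grid j.+1 n.+1 -> int}) : {ffun grid 1 n.+1 -> int} :=
  [ffun x => f (ord_max, x.2)].
pose F (f g : {ffun grid j.+1 n.+1 -> int}) :
    {ffun grid (j + j).+1 n.+1 -> int} :=
  [ffun x : 'I_(j + j).+1 * 'I_n.+1 => if (x.1 <= j)%N then f (inord x.1, x.2)
             else g (inord (j + j - x.1), x.2)].
have pE f g : p f = p g -> forall b, f (inord j, b) = g (inord j, b).
  move=> /ffunP fg b; have := fg (ord0, b); rewrite !ffunE.
  by rewrite (_ : inord j = ord_max) //; apply: val_inj; rewrite /= inordK.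
apply: (@sqr_fset_set_leq _ _ _ _ _ _ p F);
  try by apply: finite_Lip; apply: component_reps1; exact: grid_connected.
- move=> f [f0 fh]; split=> [t|x y xy].
    by rewrite inE => /eqP ->; rewrite ffunE f0 // inE.
  rewrite !ffunE; apply: fh; move: xy.
  rewrite /= /cart_adj /= (ord1 x.1) (ord1 y.1) {2}/path_adj /= andbF !orbF.
  by rewrite eqxx => ->.
- move=> f g [f0 fh] [g0 gh] /pE fg; split=> [t|[a b] [c d]].
    rewrite inE => /eqP ->; rewrite ffunE /= inordK // leqnn f0 // inE.
    by apply/eqP; congr pair; apply: val_inj; rewrite /= inordK.
  rewrite /= /cart_adj /= !ffunE /= => /orP[/andP[/eqP <- bd]|].
    by case: ifP => _; [apply: fh|apply: gh]; rewrite /= /cart_adj /= eqxx bd.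
  move=> /andP[/eqP <-].
  wlog ac : a c / (a.+1 = c)%N.
    move=> W; rewrite /path_adj => /orP[] /eqP ac.
      by apply: W => //; rewrite /path_adj ac eqxx.
    by rewrite distrC; apply: W => //; rewrite /path_adj ac eqxx.
  move=> _; have cj := ltn_ord c.
  case: leqP => aj; case: leqP => cj'; last 3 first.
  (* This edge leaves the middle row. As [f] and [g] agree there, it can be read entirely in [g]. *)
  + have aj' : (a : nat) = j by lia.
    rewrite aj' fg; apply: gh.
    by rewrite /= /cart_adj /= /path_adj /= !inordK ?eqxx ?orbT //=; lia.
  + lia.
  + apply: gh.
    by rewrite /= /cart_adj /= /path_adj /= !inordK ?eqxx ?orbT //=; lia.
  apply: fh.
  by rewrite /= /cart_adj /= /path_adj /= !inordK ?eqxx ?orbT //=; lia.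
- move=> f g f' g' _ _ _ _ /pE fg /pE fg' /ffunP e.
  have ff' a b : f (a, b) = f' (a, b).
    have := e (inord a, b); rewrite !ffunE /= inordK.
      by have := ltn_ord a; rewrite ltnS => ->; rewrite inord_val.
    by have := ltn_ord a; lia.
  split; apply/ffunP => -[a b] //.
  have := ltn_ord a; rewrite ltnS leq_eqVlt => /orP[/eqP aj|aj].
    have -> : a = inord j by apply: val_inj; rewrite /= inordK.
    by rewrite -fg -fg' ff'.
  have := e (inord (j + j - a), b); rewrite !ffunE /= inordK; last by lia.
  rewrite leqNgt (_ : (j < j + j - a)%N) /=; last by lia.
  by rewrite (_ : (j + j - (j + j - a) = a)%N) ?inord_val //; lia.
Qed.

(** Iterates [nLip_reflect], from [2 ^ k + 1] rows to [2 ^ k.+1 + 1]. The exponent of the one-row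
    count obeys [e' = 2 e + 1], whence [2 ^ k - 1]. *)
Lemma nLip_pow2 (k n h : nat) :
  (nLip 2 n.+1 h ^ 2 ^ k <=
   nLip (2 ^ k).+1 n.+1 h * nLip 1 n.+1 h ^ (2 ^ k).-1)%N.
Proof.
elim: k => [|k IH]; first by rewrite expn0 expn1 muln1.
rewrite expnS mulnC expnM; apply: (@leq_trans ((nLip (2 ^ k).+1 n.+1 h *
  nLip 1 n.+1 h ^ (2 ^ k).-1) ^ 2)%N); first by rewrite leq_exp2rW.
rewrite expnMn; apply: leq_trans (leq_mul (nLip_reflect _ _ _) (leqnn _)) _.
rewrite -expnM (mulnC (nLip 1 _ _)) -mulnA -expnS muln2 addnn -mul2n -expnS.
have k0 : (0 < 2 ^ k)%N by rewrite expn_gt0.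
rewrite [(2 ^ k * 2)%N]mulnC [(2 ^ k.+1)%N]expnS mul2n.
by rewrite (_ : (2 ^ k).-1.*2.+1 = (2 ^ k).*2.-1)%N //; lia.
Qed.

(** * The two-row grid *)

Section Ladder.
Variable h : nat.
Local Notation H := (2 * h).+1.

Let base n : grid 2 n.+1 := (ord0 : 'I_2, ord0 : 'I_n.+1).

(* The increment along the last rung, which lies in [-h, h], is shifted by
   [h]. *)
Definition rung n (u : 'I_H) : set {ffun grid 2 n.+1 -> int} :=
  Lip [set base n]%SET h `&`
  [set f | f (ord_max : 'I_2, ord_max : 'I_n.+1) =
           f (ord0 : 'I_2, ord_max : 'I_n.+1) + u%:Z - h%:Z].

Let finL n : finite_set (Lip [set base n]%SET h).
Proof. exact/finite_Lip/component_reps1/grid_connected. Qed.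

Lemma finite_rung n u : finite_set (@rung n u).
Proof. exact: finite_setIl. Qed.

Let baseP n (f : {ffun grid 2 n.+1 -> int}) : Lip [set base n]%SET h f <->
  f (base n) = 0 /\ forall x y, adj x y -> `|f x - f y| <= h%:Z.
Proof.
split=> -[f0 fh]; split => //; first by apply: f0; rewrite inE.
by move=> t; rewrite inE => /eqP ->.
Qed.

Lemma card_rung0 u : (0 < #|` fset_set (@rung 0 u)|)%N.
Proof.
rewrite cardfs_gt0; apply/fset0Pn.
exists [ffun x : 'I_2 * 'I_1 => if x.1 == ord0 then 0 else u%:Z - h%:Z].
rewrite in_fset_set ?inE; last exact: finite_rung.
split; last by rewrite /= !ffunE /= add0r.
apply/baseP; split=> [|x y xy]; first by rewrite ffunE.
rewrite !ffunE; have := ltn_ord u.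
by case: ifP => _; case: ifP => _; lia.
Qed.

Lemma sum_card_rung n :
  (\sum_u #|` fset_set (@rung n u)| <= nLip 2 n.+1 h)%N.
Proof.
rewrite (@nLipE _ _ _ (base n)).
apply: (@leq_sum_fset_set _ _ _ _ _ (fun _ => id)).
- exact: finite_rung.
- exact: finL.
- by move=> i x [].
- move=> u v f g [_ fu] [_ gv] fg; subst g; split => //; apply: val_inj.
  by move: fu gv => /= -> ; lia.
Qed.

(** Between rungs [u] and [u'], if row [ord0] moves by [d - h], the other row moves by
    [d - h + u' - u], which must lie in [[-h, h]]. The kernel counts such [d]; [|u - u'|] is written
    as a sum of two truncated differences. *)
Let card_shift (u u' : 'I_H) :
  (H - ((u - u') + (u' - u)) <=
   #|[pred d : 'I_H | u <= u' + d <= u + 2 * h]|)%N.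
Proof.
set k := (H - _)%N; set D := [pred d : 'I_H | _].
rewrite -[k]card_ord -[X in (_ <= X)%N]card_sig.
have tH (t : 'I_k) : ((u - u') + t < H)%N.
  by have := ltn_ord t; rewrite /k; lia.
have tP (t : 'I_k) : D (Ordinal (tH t)).
  by have := ltn_ord t; rewrite /k /D /=; lia.
pose F t : {d : 'I_H | D d} := Sub (Ordinal (tH t)) (tP t).
apply: (@leq_card _ _ F) => t t' /(congr1 (fun z => val (val z))) /= /addnI.
exact: val_inj.
Qed.

Lemma card_rungS n (u' : 'I_H) :
  (\sum_(u : 'I_H) (H - ((u - u') + (u' - u))) * #|` fset_set (@rung n u)| <=
   #|` fset_set (@rung n.+1 u')|)%N.
Proof.
pose ok (u d : 'I_H) := (u <= u' + d <= u + 2 * h)%N.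
(* Inadmissible pairs get the empty set, so that the sum runs over all pairs. *)
pose A (ud : 'I_H * 'I_H) := if ok ud.1 ud.2 then @rung n ud.1 else set0.
apply: (@leq_trans (\sum_ud #|` fset_set (A ud)|)%N).
  rewrite -(pair_bigA _ (fun u d => #|` fset_set (A (u, d))|)) /=.
  apply: leq_sum => u _; rewrite /A /=.
  apply: (@leq_trans (\sum_(d | ok u d) #|` fset_set (@rung n u)|)%N).
    by rewrite sum_nat_const leq_mul2r card_shift orbT.
  rewrite [X in (X <= _)%N]big_mkcond /=; apply: leq_sum => d _.
  by case: ifP.
pose F (ud : 'I_H * 'I_H) (f : {ffun grid 2 n.+1 -> int}) :
    {ffun grid 2 n.+2 -> int} :=
  [ffun x : 'I_2 * 'I_n.+2 => if (x.2 <= n)%N then f (x.1, inord x.2)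
     else f (ord0, ord_max) + ud.2%:Z - h%:Z +
          if x.1 == ord0 then 0 else u'%:Z - h%:Z].
have max_inord : inord n = ord_max :> 'I_n.+1.
  by apply: val_inj; rewrite /= inordK.
apply: (@leq_sum_fset_set _ _ _ _ _ F).
- by move=> ud; rewrite /A; case: ifP => // _; exact: finite_rung.
- exact: finite_rung.
- move=> [u d] f; rewrite /A /=; case: ifP => // okud [/baseP[f0 fh] fu].
  split; last first.
    rewrite /= !ffunE /= ltnn /= addr0; lia.
  apply/baseP; split.
    by rewrite ffunE /= -[RHS]f0; congr (f (_, _)); apply: val_inj;
      rewrite /= inordK.
  have ud := ltn_ord d; have uu := ltn_ord u; have uu' := ltn_ord u'.
  move: okud; rewrite /ok => okud.
  have frung c : `|f (ord0, c) - f (ord_max, c)| <= h%:Z.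
    by apply: fh; rewrite /= /cart_adj /= /path_adj /= eqxx ?orbT.
  have lt2 (a : 'I_2) : a = ord0 \/ a = ord_max.
    by case: a => -[|[|//]] ?; [left|right]; exact: val_inj.
  move=> [a b] [c e]; rewrite /= /cart_adj /= !ffunE /= => /orP[].
    move=> /andP[/eqP <-].
    wlog be : b e / (b.+1 = e)%N.
      move=> W; rewrite /path_adj => /orP[] /eqP be.
        by apply: W => //; rewrite /path_adj be eqxx.
      by rewrite distrC; apply: W => //; rewrite /path_adj be eqxx.
    move=> _; have := ltn_ord e; rewrite -be !ltnS => bn; rewrite bn.
    case: leqP => bn'; last
      by apply: fh; rewrite /= /cart_adj /= /path_adj /= !inordK ?eqxx //; lia.
    have -> : (b : nat) = n by lia.
    rewrite max_inord; case: (lt2 a) => -> /=; first by lia.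
    rewrite fu; move: (f _) => z; lia.
  move=> /andP[/eqP <-] ac.
  case: ifP => bn.
    by apply: fh; rewrite /= /cart_adj /= ac eqxx orbT.
  by case: ifP => _; case: ifP => _; lia.
- move=> [u d] [v e] f g; rewrite /A /=; case: ifP => // _; case: ifP => // _.
  move=> [_ fu] [_ gv] /ffunP eFG.
  have fg : f = g.
    apply/ffunP => -[a b]; have := eFG (a, inord b); rewrite !ffunE /=.
    have bn : (b <= n)%N by rewrite -ltnS.
    by rewrite inordK ?bn ?inord_val // ltnW.
  subst g; split => //.
  have := eFG (ord0, ord_max); rewrite !ffunE /= ltnn /= => de.
  have -> : u = v by apply: val_inj; move: fu gv => /= ->; lia.
  by congr pair; apply: val_inj => /=; lia.
Qed.

(** The kernel has nonnegative entries, so the subsolution inequality propagates from column to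
    column. It starts from [v u <= 1], each rung value being attained on one column. *)
Lemma ladder_lower (R : realType) (v : 'I_H -> R) (mu : R) n :
  0 <= mu -> (forall u, v u <= 1) ->
  (forall u, mu * v u <=
     \sum_(w : 'I_H) (H - ((w - u) + (u - w)))%N%:R * v w) ->
  mu ^+ n * \sum_u v u <= (nLip 2 n.+1 h)%:R.
Proof.
move=> mu0 v1 vK.
have low u : mu ^+ n * v u <= #|` fset_set (@rung n u)|%:R.
  elim: n u => [|n IH] u.
    by rewrite expr0 mul1r; apply: le_trans (v1 u) _; rewrite ler1n card_rung0.
  apply: (@le_trans _ _ (\sum_(w : 'I_H) (H - ((w - u) + (u - w)))%N%:R *
    #|` fset_set (@rung n w)|%:R)).
    rewrite exprSr -mulrA.
    apply: le_trans (ler_wpM2l (exprn_ge0 n mu0) (vK u)) _.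
    rewrite mulr_sumr; apply: ler_sum => w _.
    by rewrite mulrCA; apply: ler_wpM2l.
  under eq_bigr do rewrite -natrM.
  by rewrite -natr_sum ler_nat card_rungS.
rewrite mulr_sumr; apply: le_trans (ler_sum _ (fun u _ => low u)) _.
by rewrite -natr_sum ler_nat sum_card_rung.
Qed.

End Ladder.

(** * Convergence in the Lipschitz constant *)

(** The limit is the infimum over positive indices: for a nearly minimal [a n], the error [C n / m]
    vanishes as [m] grows. *)
Lemma cvg_almost_monotone (R : realType) (a C : R ^nat) :
  (forall n, 0 <= a n) ->
  (forall m n, (0 < m)%N -> (0 < n)%N -> a m <= a n + C n / m%:R) ->
  cvgn a.
Proof.
move=> a0 aC; pose E := [set a n.+1 | n in [set: nat]].
have Einf : has_inf E.
  by split; [exists (a 1%N), 0%N|exists 0 => _ [n _ <-]].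
have Ele n : (0 < n)%N -> inf E <= a n.
  by case: n => // n _; apply: ge_inf; [exact: Einf.2|exists n].
apply/cvg_ex; exists (inf E); apply/cvgrPdist_le => eps eps0.
have e2 : 0 < eps / 2 by rewrite divr_gt0.
have [_ [n _ <-] an] := inf_adherent e2 Einf.
exists (Num.bound (`|C n.+1| / (eps / 2))).+1 => //= m /= mK.
have m0 : (0 < m)%N by exact: leq_trans mK.
have Lm := Ele m m0; have am := aC m n.+1 m0 isT.
have : C n.+1 / m%:R <= eps / 2.
  rewrite ler_pdivrMr ?ltr0n // mulrC -ler_pdivrMr //.
  apply: (@le_trans _ _ (`|C n.+1| / (eps / 2))).
    by rewrite ler_pM2r ?invr_gt0 // ler_norm.
  have : 0 <= `|C n.+1| / (eps / 2) by rewrite divr_ge0 // ltW.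
  move=> /archi_boundP/ltW.
  move=> /le_trans; apply.
  by rewrite ler_nat ltnW.
by move=> Cm; rewrite ler_norml; apply/andP; split; lra.
Qed.

Section LipConst.
Variables (R : realType) (G : sgraph) (s : G).
Hypotheses (cG : gconnected G) (G1 : (1 < #|G|)%N).

Local Notation d := #|G|.-1.
Local Notation N h := ((card_Lip [set s]%SET h)%:R : R).

Let d0 : d%:R != 0 :> R.
Proof. by rewrite pnatr_eq0 -lt0n; lia. Qed.

Let root h := N h `^ d%:R^-1.

Let root_exp h : root h ^+ d = N h.
Proof. by rewrite -powR_mulrn ?powR_ge0 // -powRrM mulVf // powRr1. Qed.

Lemma lip_const_props :
  [/\ (fun h : nat => h%:R^-1 * root h) @ \oo --> lip_const G R,
      (fun h : nat => N h / h%:R ^+ d) @ \oo --> lip_const G R ^+ d &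
      1 <= lip_const G R].
Proof.
have /cvg_ex[L aL] : cvgn (fun h => h%:R^-1 * root h).
  (* With [k = m %/ n + 1], monotonicity and dilation give [root m <= k * root n], and
     [k / m <= 1 / n + 1 / m]; hence the error constant [root n]. *)
  apply: (@cvg_almost_monotone R _ root).
- by move=> h; rewrite mulr_ge0 ?invr_ge0 // powR_ge0.
- move=> m n m0 n0; set k := (m %/ n).+1.
  have rm : root m <= k%:R * root n.
    have -> : k%:R * root n = (k%:R ^+ d * N n) `^ d%:R^-1.
      by rewrite powRM ?exprn_ge0 // -powR_mulrn // -powRrM divff // powRr1.
    apply: ge0_ler_powR; rewrite ?invr_ge0 ?nnegrE ?mulr_ge0 ?exprn_ge0 //.
    rewrite -natrX -natrM ler_nat.
    apply: leq_trans (@card_Lip_dilate _ s cG n k isT).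
    by apply: leq_card_Lip => //; rewrite mulnC ltnW // ltn_ceil.
  apply: (@le_trans _ _ (m%:R^-1 * (k%:R * root n))).
    by rewrite ler_pM2l // invr_gt0 ltr0n.
  rewrite -[root n / _]mulrC -mulrDl mulrA ler_wpM2r ?powR_ge0 //.
  rewrite /k -natr1 mulrDr mulr1 lerD2r.
  rewrite mulrC ler_pdivrMr ?ltr0n // mulrC ler_pdivlMr ?ltr0n //.
  by rewrite -natrM ler_nat leq_trunc_div.
have e : lip_const G R = L.
  rewrite /lip_const (n_comp_connected _ s cG) subn1.
  have -> : (fun h : nat => h%:R^-1 * (card_Lip (base_reps G) h)%:R `^ d%:R^-1)
      = (fun h : nat => h%:R^-1 * root h).
    by apply/funext => h; rewrite (card_Lip_base _ s).
  exact: cvg_lim aL.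
rewrite e; split => //.
- have : (fun h : nat => (h%:R^-1 * root h) ^+ d) @ \oo --> L ^+ d.
    exact: (cvg_comp _ _ aL (@exprn_continuous R d L)).
  by under eq_fun do rewrite exprMn root_exp exprVn mulrC.
- apply: (ler_cvg_to (cvg_cst (1 : R)) aL).
  exists 1%N => //= h /= h0.
  rewrite mulrC ler_pdivlMr ?ltr0n // mul1r.
  rewrite -(@ler_pXn2r _ d) ?nnegrE ?powR_ge0 //; last by lia.
  by rewrite root_exp -natrX ler_nat card_Lip_ge.
Qed.

End LipConst.

(** * Convergence in the size of the grid *)

Section GridLimit.
Variable R : realType.
Local Notation c n := (lip_const (grid n n) R).

Lemma cvg_natV0 : (fun n : nat => n%:R^-1 : R) @ \oo --> (0 : R).
Proof. by rewrite -cvg_shiftS; exact: cvg_harmonic. Qed.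

Lemma cvg_odd_ratio : (fun h : nat => (2 * h).+1%:R / h%:R : R) @ \oo --> (2 :
  R).
Proof.
have : (fun h : nat => 2 + h%:R^-1 : R) @ \oo --> (2 + 0 : R).
  by apply: cvgD; [exact: cvg_cst|exact: cvg_natV0].
rewrite addr0; apply: cvg_trans; apply: near_eq_cvg.
exists 1%N => //= h /= h0.
by rewrite -[(2 * h).+1%:R]natr1 natrM mulrDl mul1r mulfK // pnatr_eq0 -lt0n.
Qed.

(** For [n = 1] the value of [lip_const] is a convention, but it enters with exponent 0; the bound
    by 1 is therefore claimed only from [n = 2] on. *)
Lemma nLip_props n : (0 < n)%N ->
  (fun h : nat => (nLip n n h)%:R / h%:R ^+ (n * n).-1) @ \oo
    --> c n ^+ (n * n).-1 /\ ((1 < n)%N -> 1 <= c n).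
Proof.
case: n => [//|[|n]] _.
  rewrite /= expr0; split => //.
  have -> : (fun h : nat => (nLip 1 1 h)%:R / h%:R ^+ 0 : R) = fun=> 1.
    by apply/funext => h; rewrite nLip11 expr0 divr1.
  exact: cvg_cst.
pose s : grid n.+2 n.+2 := (ord0 : 'I_n.+2, ord0 : 'I_n.+2).
have G1 : (1 < #|grid n.+2 n.+2|)%N by rewrite card_grid.
have [_ lim c1] := @lip_const_props R _ s (@grid_connected _ _) G1.
split=> //; rewrite -card_grid.
by under eq_fun do rewrite (nLipE _ _ _ s).
Qed.

(** The limit of [bLip n n h / h ^ (n * n)]; the factor 2 is the limit of [(2 h + 1) / h]. *)
Definition blockVol n : R := 2 * c n ^+ (n * n).-1.

Lemma cvg_bLip n : (0 < n)%N ->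
  (fun h : nat => (bLip n n h)%:R / h%:R ^+ (n * n)) @ \oo --> blockVol n.
Proof.
move=> n0; have [lim _] := nLip_props n n0.
have nn : (n * n = (n * n).-1.+1)%N by rewrite prednK // muln_gt0 n0.
have <- : (fun h : nat => ((2 * h).+1%:R / h%:R) *
    ((nLip n n h)%:R / h%:R ^+ (n * n).-1) : R) =
    (fun h : nat => (bLip n n h)%:R / h%:R ^+ (n * n)).
  apply/funext => h; rewrite mulrACA -invfM -natrM -exprS -nn /bLip.
  by rewrite {2}nn.
exact: cvgM cvg_odd_ratio lim.
Qed.

Lemma blockVol_ge2 n : (0 < n)%N -> 2 <= blockVol n.
Proof.
move=> n0; rewrite /blockVol ler_peMr //.
case: n n0 => [//|[|n]] _; first by rewrite expr0.
by have [_ /(_ isT) c1] := nLip_props n.+2 isT; rewrite exprn_ege1.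
Qed.

Lemma blockVol_square q n r : (0 < n)%N -> (0 < q * n + r)%N ->
  blockVol (q * n + r) <=
  blockVol n ^+ (q ^ 2) * 2 ^+ ((q * n + r) ^ 2 - (q * n) ^ 2).
Proof.
move=> n0 N0; set N := (q * n + r)%N in N0 *; set e := (N ^ 2 - (q * n) ^ 2)%N.
have limN := cvg_bLip N N0.
have limn : (fun h : nat => ((bLip n n h)%:R / h%:R ^+ (n * n)) ^+ (q ^ 2)
    * ((2 * h).+1%:R / h%:R) ^+ e : R) @ \oo -->
    blockVol n ^+ (q ^ 2) * 2 ^+ e.
  apply: cvgM.
    exact: (cvg_comp _ _ (cvg_bLip n n0) (@exprn_continuous R _ _)).
  exact: (cvg_comp _ _ cvg_odd_ratio (@exprn_continuous R _ _)).
apply: (ler_cvg_to limN limn); exists 1%N => //= h /= h0.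
rewrite !expr_div_n mulrACA -invfM -exprM -exprD.
have -> : (n * n * q ^ 2 + e = N * N)%N by rewrite /e /N; lia.
rewrite ler_pM2r ?invr_gt0 ?exprn_gt0 ?ltr0n //.
by rewrite -!natrX -natrM ler_nat bLip_square.
Qed.

Lemma cvg_ln_blockVol :
  cvgn (fun n : nat => ln (blockVol n) / (n%:R ^+ 2) : R).
Proof.
have ln2 : 0 <= ln 2 :> R by rewrite ln_ge0 // ler1n.
have lW n : (0 < n)%N -> 0 <= ln (blockVol n).
  by move=> n0; rewrite ln_ge0 // (le_trans _ (blockVol_ge2 n n0)) // ler1n.
(* The border left by blocks of side [n] in a square of side [m] has at most [2 n m] vertices, each
   costing [ln 2]. *)
apply: (@cvg_almost_monotone R _ (fun n => 2 * n%:R * ln 2)).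
- case=> [|n]; first by rewrite expr0n invr0 mulr0.
  by rewrite divr_ge0 ?exprn_ge0 // lW.
- move=> m n m0 n0; set q := (m %/ n)%N; set r := (m %% n)%N.
  have mE : m = (q * n + r)%N by exact: divn_eq.
  have rn : (r < n)%N by rewrite ltn_mod.
  have W0 k : (0 < k)%N -> 0 < blockVol k.
    by move=> k0; apply: lt_le_trans (blockVol_ge2 k k0).
  have := blockVol_square q n r n0; rewrite -mE => /(_ m0).
  rewrite -ler_ln ?posrE ?W0 ?mulr_gt0 ?exprn_gt0 ?W0 //.
  rewrite [in leRHS]lnM ?posrE ?W0 ?exprn_gt0 ?W0 // !lnXn ?W0 // => le.
  rewrite ler_pdivrMr ?exprn_gt0 ?ltr0n //; apply: le_trans le _.
  have mR : 0 < m%:R :> R by rewrite ltr0n.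
  have nR : 0 < n%:R :> R by rewrite ltr0n.
  rewrite mulrDl; apply: lerD.
    rewrite -[ln _ *+ _]mulr_natr natrX -[leRHS]mulrA ler_wpM2l ?lW //.
    rewrite mulrC ler_pdivlMr ?exprn_gt0 // -exprMn -natrM.
    by rewrite lerXn2r ?nnegrE // ler_nat mE leq_addr.
  rewrite -[ln 2 *+ _]mulr_natl.
  have -> : 2 * n%:R * ln 2 / m%:R * m%:R ^+ 2 = (2 * n * m)%N%:R * ln 2 :> R.
    by rewrite !natrM; field; rewrite gt_eqF.
  rewrite ler_wpM2r //.
  by rewrite ler_nat mE; nia.
Qed.

Lemma cvg_ln_lip_const : cvgn (fun n : nat => ln (c n)).
Proof.
have /cvg_ex[L aL] := cvg_ln_blockVol.
have uL : (fun n : nat => n%:R^-1 ^+ 2 : R) @ \oo --> (0 : R).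
  rewrite -[X in _ --> X](expr0n _ 2).
  exact: (cvg_comp _ _ cvg_natV0 (@exprn_continuous R _ _)).
(* This solves [ln (blockVol n) = ln 2 + (n ^ 2 - 1) * ln (c n)] for [ln (c n)]. *)
have lim : (fun n : nat => (ln (blockVol n) / n%:R ^+ 2 - n%:R^-1 ^+ 2 * ln 2) *
    (1 - n%:R^-1 ^+ 2)^-1) @ \oo --> (L - 0 * ln 2) * (1 - 0)^-1.
  apply: cvgM; first by apply: cvgB => //; apply: cvgM => //; exact: cvg_cst.
  apply: cvgV; first by rewrite subr0 oner_eq0.
  by apply: cvgB => //; exact: cvg_cst.
apply/cvg_ex; exists ((L - 0 * ln 2) * (1 - 0)^-1).
apply: cvg_trans lim; apply: near_eq_cvg; exists 2%N => //= n /= n2.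
have [_ /(_ n2) c1] := nLip_props n (ltnW n2).
have c0 : 0 < c n by exact: lt_le_trans c1.
rewrite /blockVol lnM ?posrE ?exprn_gt0 // lnXn // -[ln (lip_const _ _) *+
  _]mulr_natr.
have -> : (n * n).-1%:R = n%:R ^+ 2 - 1 :> R.
  by rewrite -natrX -mulnn -[in RHS](@prednK (n * n)) -?natr1 ?addrK //
    muln_gt0 !(ltnW n2).
have n2R : 2 <= n%:R :> R by rewrite ler_nat.
have n0 : n%:R != 0 :> R by rewrite gt_eqF //; lra.
have n1 : n%:R ^+ 2 - 1 != 0 :> R by rewrite gt_eqF //; nra.
by field; rewrite n0 n1.
Qed.

Lemma lip_const_grid_cvg : cvgn (fun n : nat => c n).
Proof.
have /cvg_ex[L lL] := cvg_ln_lip_const.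
apply/cvg_ex; exists (expR L).
have : (fun n : nat => expR (ln (c n))) @ \oo --> expR L.
  exact: (cvg_comp _ _ lL (@continuous_expR R L)).
apply: cvg_trans; apply: near_eq_cvg; exists 2%N => //= n /= n2.
have [_ /(_ n2) c1] := nLip_props n (ltnW n2).
by rewrite lnK // posrE (lt_le_trans _ c1).
Qed.

(** * From two-row grids to the limit *)

Lemma nLip1_le n h : (nLip 1 n.+1 h <= (2 * h).+1 ^ n)%N.
Proof.
have := bLip_le 1 n.+1 h; rewrite /bLip mul1n /= expnS leq_pmul2l //.
Qed.

(** Inserting the two-row bound into [nLip_pow2] on the square of side [p + 1], with [p = 2 ^ k],
    and letting [h] grow bounds [c p.+1 ^+ p.+2] below by [b ^+ p]. The ratio [p / (p + 2)] tends to
    1. *)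
Lemma lip_const_grid_ge (b : R) : 1 <= b ->
  (forall n h, (0 < h)%N ->
     h%:R * (2 * h%:R ^+ 2 * b) ^+ n <= (nLip 2 n.+1 h)%:R) ->
  b <= limn (fun n : nat => c n).
Proof.
move=> b1 lad; have b0 : 0 < b by exact: lt_le_trans b1.
have key k : let p := (2 ^ k)%N in b ^+ p <= c p.+1 ^+ p.+2.
  move=> p; have p0 : (0 < p)%N by rewrite expn_gt0.
  have [lim /(_ p0) c1] := nLip_props p.+1 isT.
  have pp : ((p.+1 * p.+1).-1 = p * p.+2)%N by lia.
  have : (2 * b) ^+ (p * p) <= c p.+1 ^+ (p * p.+2) * 2 ^+ (p * p.-1).
    rewrite pp in lim.
    have lim2 : (fun h : nat => (nLip p.+1 p.+1 h)%:R / h%:R ^+ (p * p.+2) *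
        ((2 * h).+1%:R / h%:R) ^+ (p * p.-1) : R) @ \oo -->
        c p.+1 ^+ (p * p.+2) * 2 ^+ (p * p.-1).
      apply: cvgM => //.
      exact: (cvg_comp _ _ cvg_odd_ratio (@exprn_continuous R _ _)).
    apply: (ler_cvg_to (cvg_cst ((2 * b) ^+ (p * p))) lim2);
      exists 1%N => //= h /= h0.
    have hR : 0 < h%:R :> R by rewrite ltr0n.
    rewrite expr_div_n mulrACA -invfM -exprD ler_pdivlMr ?exprn_gt0 //.
    have := nLip_pow2 k p h; rewrite -/p => /leq_trans.
    move=> /(_ (nLip p.+1 p.+1 h * ((2 * h).+1 ^ p) ^ p.-1)%N).
    rewrite leq_mul2l leq_exp2rW ?nLip1_le ?orbT // => /(_ isT).
    rewrite -(ler_nat R) natrM !natrX -exprM => /(le_trans _); apply.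
    apply: le_trans (lerXn2r p _ _ (lad p h h0)); last 2 first.
    - by rewrite nnegrE mulr_ge0 ?exprn_ge0 // !mulr_ge0 ?exprn_ge0 // ltW.
    - by rewrite nnegrE.
    (* The power of [h] in the denominators is exactly the one in [(h (2 h ^ 2 b) ^ p) ^ p]. *)
    have -> : (p * p.+2 + p * p.-1 = p + 2 * (p * p))%N.
      by case: (p) p0 => // q _ /=; lia.
    rewrite [leRHS]exprMn -exprM [2 * _ * b]mulrAC exprD mulrCA.
    by rewrite [X in _ <= _ * X]exprMn -exprM.
  move=> le; rewrite -(@ler_pXn2r _ p) ?nnegrE ?exprn_ge0 ?(ltW b0) //;
    last by apply: le_trans c1.
  rewrite -!exprM (mulnC p.+2).
  (* Raising the exponent of 2 from [p * p.-1] to [p * p] lets the powers of 2 cancel. *)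
  have : (2 * b) ^+ (p * p) <= c p.+1 ^+ (p * p.+2) * 2 ^+ (p * p).
    apply: le_trans le _; rewrite ler_wpM2l ?exprn_ge0 ?(le_trans _ c1) //.
    by rewrite ler_weXn2l ?ler1n // leq_mul2l leq_pred orbT.
  by rewrite exprMn mulrC ler_pM2r // exprn_gt0.
have /cvg_ex[L cL] := lip_const_grid_cvg.
rewrite (cvg_lim _ cL) //.
(* The limit exists, so it can be computed along the sides [2 ^ k + 1]. *)
have phi : (fun k : nat => (2 ^ k).+1) @ \oo --> \oo.
  move=> S [K _ KS]; exists K => // k /= Kk; apply: KS => /=.
  by apply: leq_trans Kk _; rewrite ltnW // ltnS ltnW // ltn_expl.
have cphi := cvg_comp _ _ phi cL.
have L1 : 1 <= L.
  apply: (ler_cvg_to (cvg_cst (1 : R)) cphi); exists 0%N => //= k _.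
  by have [_ ->] := nLip_props (2 ^ k).+1 isT; rewrite // ltnS expn_gt0.
have L0 : 0 < L by exact: lt_le_trans L1.
rewrite -ler_ln ?posrE //.
have lnphi := cvg_comp _ _ cphi (continuous_ln L0).
have wphi : (fun k : nat => ln b * (1 - 2 * (2 ^ k).+2%:R^-1)) @ \oo -->
    ln b * (1 - 2 * 0).
  apply: cvgM; first exact: cvg_cst.
  apply: cvgB; first exact: cvg_cst.
  apply: cvgM; first exact: cvg_cst.
  apply: (cvg_comp (fun k : nat => (2 ^ k).+2) (fun n :
    nat => n%:R^-1) _ cvg_natV0).
  move=> S [K _ KS]; exists K => // k /= Kk; apply: KS => /=.
  by apply: leq_trans Kk _; rewrite 2?ltnW // !ltnS 1?ltnW // ltn_expl.
rewrite -[leLHS]mulr1 -[X in _ * X](subr0 1) -[X in _ - X](mulr0 2).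
apply: (ler_cvg_to wphi lnphi); exists 0%N => //= k _.
have := key k; set p := (2 ^ k)%N => /= le.
have p0 : (0 < p)%N by rewrite expn_gt0.
have [_ /(_ p0) c1] := nLip_props p.+1 isT.
have c0 : 0 < c p.+1 by exact: lt_le_trans c1.
move: le; rewrite -ler_ln ?posrE ?exprn_gt0 // !lnXn // -![ln _ *+
  _]mulr_natr => le.
have p2 : 0 < p.+2%:R :> R by rewrite ltr0n.
rewrite -(ler_pM2r p2); apply: le_trans le; rewrite -mulrA ler_wpM2l ?ln_ge0 //.
by rewrite mulrBl -mulrA mulVf ?gt_eqF // mulr1 mul1r -!natr1; lra.
Qed.

End GridLimit.

(** * Taylor bounds for sine and cosine *)

Section Taylor.
Variable R : realType.
Implicit Types (x : R) (n : nat).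

Lemma ge0_of_derive (f df : R -> R) : f 0 = 0 ->
  (forall x, is_derive x 1 f (df x)) -> (forall x, 0 <= x -> 0 <= df x) ->
  forall x, 0 <= x -> 0 <= f x.
Proof.
move=> f0 fdf df0 x x0.
have cf : {within `[0, x], continuous f}.
  apply: derivable_within_continuous => y _;
    exact: (@ex_derive _ _ _ _ _ _ _ (fdf y)).
have [y] := MVT_segment x0 (fun y _ => fdf y) cf.
rewrite in_itv /= f0 !subr0 => /andP[y0 _] ->.
by rewrite mulr_ge0 ?df0.
Qed.

Definition sin_poly n : {poly R} :=
  \sum_(i < n) ((-1) ^+ i / (i.*2.+1)`!%:R) *: 'X^(i.*2.+1).

Definition cos_poly n : {poly R} :=
  \sum_(i < n) ((-1) ^+ i / (i.*2)`!%:R) *: 'X^(i.*2).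

Lemma deriv_sin_poly n : (sin_poly n)^`() = cos_poly n.
Proof.
rewrite /sin_poly /cos_poly raddf_sum; apply: eq_bigr => i _ /=.
rewrite derivZ derivXn /= -['X^_ *+ _]scaler_nat scalerA; congr (_ *: _).
by rewrite factS natrM invfM -mulrA [X in _ * X]mulrAC mulVf ?mul1r //
  pnatr_eq0.
Qed.

Lemma deriv_cos_poly n : (cos_poly n.+1)^`() = - sin_poly n.
Proof.
rewrite /sin_poly /cos_poly raddf_sum big_ord_recl /=.
rewrite derivZ derivXn /= mulr0n scaler0 add0r -sumrN; apply: eq_bigr => i _.
rewrite derivZ derivXn /= -['X^_ *+ _]scaler_nat scalerA -scaleNr;
  congr (_ *: _).
rewrite /bump /= add1n doubleS /= factS natrM invfM -mulrA exprS mulN1r.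
by rewrite [X in _ * X]mulrAC mulVf ?mul1r ?mulNr // pnatr_eq0.
Qed.

Lemma horner_sin_poly0 n : (sin_poly n).[0] = 0.
Proof.
rewrite /sin_poly horner_sum big1 // => i _.
by rewrite hornerZ hornerXn expr0n /= mulr0.
Qed.

Lemma horner_cos_poly0 n : (cos_poly n.+1).[0] = 1.
Proof.
rewrite /cos_poly horner_sum big_ord_recl big1 /= => [|i _].
  by rewrite hornerZ hornerXn addr0 divr1 mul1r.
by rewrite hornerZ hornerXn expr0n /= mulr0.
Qed.

(* The Taylor polynomials of cos and sin are alternately above and below on
   [0, +oo[; each bound is the integral of the previous one. *)
Lemma cos_sin_taylor n x : 0 <= x ->
  0 <= (-1) ^+ n.+1 * (cos x - (cos_poly n.+1).[x]) /\
  0 <= (-1) ^+ n.+1 * (sin x - (sin_poly n.+1).[x]).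
Proof.
have step_sin k : (forall x, 0 <= x ->
      0 <= (-1) ^+ k * (cos x - (cos_poly k).[x])) ->
    forall x, 0 <= x -> 0 <= (-1) ^+ k * (sin x - (sin_poly k).[x]).
  move=> H; apply: (@ge0_of_derive ((-1) ^+ k \*:
    (sin - horner (sin_poly k)))) H.
    by rewrite /= !fctE sin0 horner_sin_poly0 subrr scaler0.
  by move=> y; apply: is_derive_eq; rewrite deriv_sin_poly.
have step_cos k : (forall x, 0 <= x ->
      0 <= (-1) ^+ k * (sin x - (sin_poly k).[x])) ->
    forall x, 0 <= x -> 0 <= (-1) ^+ k.+1 * (cos x - (cos_poly k.+1).[x]).
  move=> H; apply: (@ge0_of_derive ((-1) ^+ k.+1 \*:
    (cos - horner (cos_poly k.+1)))) H.
    by rewrite /= !fctE cos0 horner_cos_poly0 subrr scaler0.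
  move=> y; apply: is_derive_eq; rewrite deriv_cos_poly hornerN opprK.
  by rewrite exprS mulN1r scaleNr -scalerN opprD opprK.
have c1 y : 0 <= y -> 0 <= (-1) ^+ 1 * (cos y - (cos_poly 1).[y]).
  move=> _; rewrite /cos_poly big_ord1 hornerZ hornerXn divr1 mul1r.
  by rewrite mulN1r opprB subr_ge0 cos_le1.
have c n' : forall y, 0 <= y -> 0 <= (-1) ^+
  n'.+1 * (cos y - (cos_poly n'.+1).[y]).
  by elim: n' => // n' IH; apply/step_cos/step_sin.
by move=> x0; split; [exact: c|apply: step_sin => //; exact: c].
Qed.

Lemma horner_sin_poly n x : (sin_poly n).[x] =
  \sum_(i < n) (-1) ^+ i / (i.*2.+1)`!%:R * x ^+ i.*2.+1.
Proof.
by rewrite horner_sum; apply: eq_bigr => i _; rewrite hornerZ hornerXn.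
Qed.

Lemma horner_cos_poly n x : (cos_poly n).[x] =
  \sum_(i < n) (-1) ^+ i / (i.*2)`!%:R * x ^+ i.*2.
Proof.
by rewrite horner_sum; apply: eq_bigr => i _; rewrite hornerZ hornerXn.
Qed.

(* The factorials are split into products of small numerals, which are unary. *)
Lemma cos_ge10 x : 0 <= x ->
  1 - x ^+ 2 / 2 + x ^+ 4 / 24 - x ^+ 6 / 720 + x ^+ 8 / (720 * 56)
    - x ^+ 10 / (720 * 720 * 7) <= cos x.
Proof.
move=> /(cos_sin_taylor 5)[+ _]; rewrite horner_cos_poly.
rewrite !big_ord_recr big_ord0 /= !factS fact0 !natrM /double /=.
lra.
Qed.

Lemma cos_le8 x : 0 <= x ->
  cos x <= 1 - x ^+ 2 / 2 + x ^+ 4 / 24 - x ^+ 6 / 720 + x ^+ 8 / (720 * 56).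
Proof.
move=> /(cos_sin_taylor 4)[+ _]; rewrite horner_cos_poly.
rewrite !big_ord_recr big_ord0 /= !factS fact0 !natrM /double /=.
lra.
Qed.

Lemma sin_le9 x : 0 <= x ->
  sin x <= x - x ^+ 3 / 6 + x ^+ 5 / 120 - x ^+ 7 / (720 * 7) + x ^+
    9 / (720 * 504).
Proof.
move=> /(cos_sin_taylor 4)[_]; rewrite horner_sin_poly.
rewrite !big_ord_recr big_ord0 /= !factS fact0 !natrM /double /=.
lra.
Qed.

Lemma sin_ge7 x : 0 <= x ->
  x - x ^+ 3 / 6 + x ^+ 5 / 120 - x ^+ 7 / (720 * 7) <= sin x.
Proof.
move=> /(cos_sin_taylor 3)[_]; rewrite horner_sin_poly.
rewrite !big_ord_recr big_ord0 /= !factS fact0 !natrM /double /=.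
lra.
Qed.

Lemma cos_ge2 x : 0 <= x -> 1 - x ^+ 2 / 2 <= cos x.
Proof.
move=> /(cos_sin_taylor 1)[+ _]; rewrite horner_cos_poly.
rewrite !big_ord_recr big_ord0 /= !factS fact0 !natrM /double /=.
lra.
Qed.

Lemma sin_le_id x : 0 <= x -> sin x <= x.
Proof.
move=> /(cos_sin_taylor 0)[_]; rewrite horner_sin_poly.
rewrite !big_ord_recr big_ord0 /= !factS fact0 !natrM /double /=.
lra.
Qed.

Lemma sin_ge3 x : 0 <= x -> x - x ^+ 3 / 6 <= sin x.
Proof.
move=> /(cos_sin_taylor 1)[_]; rewrite horner_sin_poly.
rewrite !big_ord_recr big_ord0 /= !factS fact0 !natrM /double /=.
lra.
Qed.

End Taylor.

(* [theta] lies between the simplest fractions that determine [theta ^ -2] to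
   the required accuracy. *)
Lemma tan_sol_lower (R : realType) (x := 2581 / 3000 : R) :
  x * sin x - cos x < 0.
Proof.
have x0 : 0 <= x by rewrite /x; lra.
have C := cos_ge10 _ _ x0; have S := sin_le9 _ _ x0.
by move: C S; rewrite /x; lra.
Qed.

Lemma tan_sol_upper (R : realType) (x := 154 / 179 : R) :
  0 < x * sin x - cos x.
Proof.
have x0 : 0 <= x by rewrite /x; lra.
have C := cos_le8 _ _ x0; have S := sin_ge7 _ _ x0.
by move: C S; rewrite /x; lra.
Qed.

(** * The eigenvalue bound and the constant *)

Section Eigen.
Variables (R : realType) (h : nat) (theta x : R).
Hypotheses (h0 : (0 < h)%N) (th0 : 0 < theta) (th1 : theta < 1).
Hypothesis thE : theta * sin theta = cos theta.
Hypothesis thx : theta = 2 * h%:R * x.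
Local Notation H := (2 * h).+1.

Let hR : 0 < h%:R :> R. Proof. by rewrite ltr0n. Qed.
Let x0 : 0 < x.
Proof. by move: th0; rewrite thx pmulr_rgt0 // mulr_gt0. Qed.

(** The angle runs through [[-theta, theta]] in steps of [2 x = theta / h]. *)
Definition cos_vec (w : nat) : R := cos (2 * x * (w%:R - h%:R)).
Local Notation v := cos_vec.
(** Sines at the midpoints of the steps: up to the factor [2 e], they are discrete antiderivatives
    of [v], and minus its differences. *)
Let s (w : nat) : R := sin (2 * x * (w%:R - h%:R) - x).
Let e : R := sin x.

Let hx : 2 * x <= theta.
Proof.
by rewrite thx mulrAC ler_peMr ?ler1n // mulr_ge0 // ltW.
Qed.

Let sin_gt0 (y : R) : 0 < y -> y <= 1 -> 0 < sin y.
Proof. by move=> y0 y1; apply: sin2_gt0; rewrite y0 /=; lra. Qed.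

Let e0 : 0 < e.
Proof. by apply: sin_gt0 => //; move: hx th1; lra. Qed.

Let sum_v k : 2 * e * (\sum_(w < k) v w) = s k - s 0.
Proof.
elim: k => [|k IH]; first by rewrite big_ord0 mulr0 subrr.
have -> : s k.+1 = s k + 2 * e * v k.
  rewrite /s /cos_vec /e -[k.+1%:R]natr1.
  have -> : 2 * x * (k%:R + 1 - h%:R) - x = 2 * x * (k%:R - h%:R) + x by ring.
  by rewrite sinD sinB; ring.
by rewrite big_ord_recr /= mulrDr IH addrAC.
Qed.

Let diff_v k : v k.+1 - v k = - (2 * e * s k.+1).
Proof.
rewrite /s /cos_vec /e -[k.+1%:R]natr1.
set y := 2 * x * (k%:R - h%:R) + x.
have -> : 2 * x * (k%:R + 1 - h%:R) = y + x by rewrite /y; ring.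
have -> : 2 * x * (k%:R - h%:R) = y - x by rewrite /y; ring.
have -> : y + x - x = y by ring.
by rewrite cosB cosD; ring.
Qed.

Let s_last : s H = sin (theta + x).
Proof.
by rewrite /s -[H%:R]natr1 natrM; congr sin; rewrite thx; ring.
Qed.

Let s_first : s 0 = - s H.
Proof.
rewrite s_last /s -sinN; congr sin; rewrite thx; ring.
Qed.

Let T (u : nat) : R :=
  \sum_(w < H) (H - ((w - u) + (u - w)))%N%:R * v w.

(** The reversal of the index fixes [v] and turns the weight [H - w] into [w + 1]; the two weights
    average to [h + 1]. *)
Let T0 : 2 * e * T 0 = 2 * (h%:R + 1) * s H.
Proof.
have TE : T 0 = \sum_(w < H) (H - w)%N%:R * v w.
  by apply: eq_bigr => w _; rewrite subn0 sub0n addn0.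
have v_rev (w : 'I_H) : v (rev_ord w) = v w.
  rewrite /v /= subSS natrB; last by rewrite -ltnS.
  by rewrite natrM -[LHS]cosN; congr cos; ring.
have : 2 * T 0 = \sum_(w < H) (2 * h.+1)%:R * v w.
  rewrite mulr_natl mulr2n {1}TE (reindex_inj rev_ord_inj) /= TE -big_split /=.
  apply: eq_bigr => w _; rewrite v_rev -mulrDl -natrD; congr (_%:R * _).
  have := ltn_ord w; lia.
rewrite -mulr_sumr => T2.
have := sum_v H; rewrite s_first opprK => Hs.
have -> : 2 * e * T 0 = e * (2 * T 0) by ring.
rewrite T2 natrM -natr1.
by have := congr1 (fun z => (h%:R + 1) * z) Hs => /= Hs2; lra.
Qed.

(** From [u] to [u + 1] the weight drops by 1 for [w <= u] and grows by 1 for [w > u]; both sums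
    telescope by [sum_v]. *)
Let T_step u : (u.+1 < H)%N -> e * (T u.+1 - T u) = - s u.+1.
Proof.
move=> uH.
have Td : T u.+1 - T u = \sum_(w < H) v w - 2 * \sum_(w < u.+1) v w.
  rewrite -sumrB (big_ord_widen H (fun w => v w) (ltnW uH)) [X in _ *
    X]big_mkcond /=.
  rewrite mulr_sumr -sumrB; apply: eq_bigr => w _; rewrite -mulrBl.
  have wH := ltn_ord w; case: ifP => wu.
    rewrite (_ : (H - (w - u + (u - w)) = (H - (w - u.+1 + (u.+1 - w))).+1)%N).
      by rewrite -natr1; ring.
    by lia.
  rewrite (_ : (H - (w - u.+1 + (u.+1 - w)) = (H - (w - u + (u - w))).+1)%N).
    by rewrite -natr1; ring.
  by lia.
have Hs := sum_v H; have us := sum_v u.+1; move: Hs us.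
rewrite s_first opprK Td mulrBr => Hs us.
lra.
Qed.

(** By [T_step] and [diff_v], both terms change by [- s u.+1 / e] at each step. *)
Let T_cst u : (u < H)%N -> T u - v u / (2 * e ^+ 2) = T 0 - v 0 / (2 * e ^+ 2).
Proof.
elim: u => // u IH uH; rewrite -IH; last exact: ltnW.
have eN : e != 0 by rewrite gt_eqF.
have -> : T u.+1 = T u - s u.+1 / e.
  by rewrite -[s u.+1]opprK -(T_step u uH); field.
have -> : v u.+1 = v u - 2 * e * s u.+1 by rewrite -diff_v addrC subrK.
by field.
Qed.

Let sin_th0 : 0 < sin theta. Proof. by apply: sin_gt0 => //; exact: ltW. Qed.

(* [T u - v u / (2 e ^ 2)] does not depend on [u], since both terms have the
   same second difference; [theta tan theta = 1] makes it nonnegative at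
   [u = 0]. *)
Let T_cst_ge0 : v 0 / (2 * e ^+ 2) <= T 0.
Proof.
have v0 : v 0 = theta * sin theta.
  by rewrite thE /v -[RHS]cosN; congr cos; rewrite thx; ring.
rewrite ler_pdivrMr ?mulr_gt0 ?exprn_gt0 //.
have -> : T 0 * (2 * e ^+ 2) = e * (2 * e * T 0) by ring.
rewrite T0 s_last sinD -thE v0.
have -> : e * (2 * (h%:R + 1) * (sin theta * cos x + theta * sin theta * sin x))
   = (2 * (h%:R + 1) * e * (cos x + theta * e)) * sin theta by rewrite /e; ring.
rewrite ler_pM2r //.
have e3 : x - x ^+ 3 / 6 <= e by apply: sin_ge3; exact: ltW.
have c2 : 1 - x ^+ 2 / 2 <= cos x by apply: cos_ge2; exact: ltW.
have h1 : 1 <= h%:R :> R by rewrite ler1n.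
have x2 : x <= 1 / 2 by move: hx th1; lra.
have xp : 0 < x by [].
have thp : 2 * x <= theta by [].
(* After division by [sin theta], the claim is the product of [A] and [B]. Here [cos x] loses at
   most [x ^ 2 / 2], while [theta * e] gains almost [2 x ^ 2], since [theta >= 2 x]. *)
have A : 1 <= cos x + theta * e.
  have : theta * (x - x ^+ 3 / 6) <= theta * e by rewrite ler_pM2l.
  have : 2 * x * (x - x ^+ 3 / 6) <= theta * (x - x ^+ 3 / 6).
    by rewrite ler_wpM2r //; nra.
  have : 0 <= x ^+ 2 * (3 / 2 - x ^+ 2 / 3).
    by rewrite mulr_ge0 ?exprn_ge0 ?(ltW xp) //; nra.
  lra.
(* As [theta = 2 h x], the extra 1 in [h + 1] pays for the cubic loss of the sine. *)
have B : theta <= 2 * (h%:R + 1) * e.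
  apply: (@le_trans _ _ (2 * (h%:R + 1) * (x - x ^+ 3 / 6))); last first.
    by rewrite ler_pM2l // mulr_gt0 // ltr_wpDl.
  rewrite thx.
  have hx1 : 2 * h%:R * x <= 1 by rewrite -thx ltW.
  have : 0 <= x * (1 - x ^+ 2 / 6 - h%:R * x ^+ 2 / 6).
    rewrite mulr_ge0 ?ltW //.
    have : h%:R * x * x <= 1 / 2 * x by rewrite ler_pM2r //; lra.
    nra.
  nra.
by rewrite -[leLHS]mulr1 ler_pM // ltW.
Qed.

(** All angles are at most 1 in absolute value, and [cos y >= 1 - y ^ 2 / 2]. *)
Let cos_vec_ge (u : 'I_H) : 2^-1 <= v u.
Proof.
rewrite /v -cos_norm; set y := _ * _.
have y1 : `|y| <= 1.
  have xu : x * u%:R <= x * (2 * h%:R).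
    by rewrite ler_wpM2l ?(ltW x0) // -natrM ler_nat -ltnS.
  have : 0 <= x * u%:R by rewrite mulr_ge0 // ltW.
  move: th1 xu; rewrite /y thx ler_norml => ? ? ?.
  by apply/andP; split; lra.
have := cos_ge2 _ _ (normr_ge0 y); have := normr_ge0 y; nra.
Qed.

(** The preceding bounds give the factor [1 / (2 sin(x) ^ 2)]; by [sin x <= x] it is at least
    [1 / (2 x ^ 2) = 2 h ^ 2 / theta ^ 2]. *)
Lemma cos_vec_eigen (u : 'I_H) : 2 * h%:R ^+ 2 * theta ^- 2 * v u <=
  \sum_(w < H) (H - ((w - u) + (u - w)))%N%:R * v w.
Proof.
have vu0 : 0 <= v u by apply: le_trans (cos_vec_ge u); rewrite invr_ge0.
apply: (@le_trans _ _ (v u / (2 * e ^+ 2))).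
  rewrite mulrC ler_wpM2l //.
  have ex : e <= x by apply: sin_le_id; exact: ltW.
  have -> : 2 * h%:R ^+ 2 * theta ^- 2 = (2 * x ^+ 2)^-1.
    by rewrite thx; field; rewrite !gt_eqF.
  rewrite lef_pV2 ?posrE ?mulr_gt0 ?exprn_gt0 // ler_pM2l //.
  by rewrite lerXn2r // nnegrE ltW.
have := T_cst u (ltn_ord u); have := T_cst_ge0; rewrite -/(T u); lra.
Qed.

Lemma sum_cos_vec_ge : h%:R <= \sum_(u < H) v u.
Proof.
apply: (@le_trans _ _ (\sum_(u < H) 2^-1)).
  rewrite sumr_const card_ord -[leRHS]mulr_natl -[H%:R]natr1 natrM; lra.
by apply: ler_sum => u _; exact: cos_vec_ge.
Qed.

Lemma nLip2_cos_ge n :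
  h%:R * (2 * h%:R ^+ 2 * theta ^- 2) ^+ n <= (nLip 2 n.+1 h)%:R.
Proof.
have mu0 : 0 <= 2 * h%:R ^+ 2 * theta ^- 2 :> R.
  by rewrite mulr_ge0 ?invr_ge0 ?mulr_ge0 ?exprn_ge0 // ltW.
apply: le_trans (@ladder_lower h R (fun u => v u) _ n mu0 _ _); last 2 first.
- by move=> u; exact: cos_le1.
- exact: cos_vec_eigen.
by rewrite mulrC ler_wpM2l ?exprn_ge0 // sum_cos_vec_ge.
Qed.

End Eigen.

Lemma nLip2_ge (R : realType) (theta : R) n h : (0 < h)%N ->
  0 < theta -> theta < 1 -> theta * sin theta = cos theta ->
  h%:R * (2 * h%:R ^+ 2 * theta ^- 2) ^+ n <= (nLip 2 n.+1 h)%:R.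
Proof.
move=> h0 th0 th1 thE.
apply: (@nLip2_cos_ge _ _ _ (theta / (2 * h%:R))) => //.
by field; rewrite pnatr_eq0 -lt0n.
Qed.

(** * The root [theta] and the value of [alpha] *)

Lemma theta_exists (R : realType) : exists theta : R,
  [/\ 2581 / 3000 < theta, theta < 154 / 179 &
      theta * sin theta = cos theta].
Proof.
pose g (x : R) := x * sin x - cos x.
have ga : g (2581 / 3000) < 0 by exact: tan_sol_lower.
have gb : 0 < g (154 / 179) by exact: tan_sol_upper.
have cg : {within `[2581 / 3000, 154 / 179], continuous g}.
  apply: derivable_within_continuous => y _; exact: ex_derive.
have [|||c] := @IVT R g (2581 / 3000) (154 / 179) 0 => //.
- lra.
- by rewrite ge_min le_max (ltW ga) (ltW gb) orbT.
rewrite in_itv /= => /andP[ac cb] gc.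
exists c; split.
- rewrite lt_neqAle ac andbT; apply/eqP => acE.
  by move: ga; rewrite acE gc ltxx.
- rewrite lt_neqAle cb andbT; apply/eqP => acE.
  by move: gb; rewrite -acE gc ltxx.
- by apply/eqP; rewrite -subr_eq0; apply/eqP.
Qed.

(** A larger solution would have an inverse [y] with [0 < y < theta] and [y sin y = cos y], but on
    this range [y sin y] increases and [cos y] decreases. *)
Lemma largest_tan_inv_sol_theta (R : realType) (theta : R) :
  0 < theta -> theta < 1 -> theta * sin theta = cos theta ->
  largest_tan_inv_sol theta^-1.
Proof.
move=> th0 th1 thE; have pi2 := @pihalf_ge1 R.
have s0 : 0 < sin theta by apply: sin2_gt0; rewrite th0 /=; lra.
split; first split; rewrite ?invrK.
- by rewrite invr_eq0 gt_eqF.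
- by rewrite -thE gt_eqF // mulr_gt0.
- by rewrite /tan -thE invfM mulrCA divff ?mulr1 // gt_eqF.
move=> x [x0 cx xE]; case: (leP x 0) => [x_le0|x_gt0].
  by apply: le_trans x_le0 _; rewrite invr_ge0 ltW.
rewrite leNgt; apply/negP => thx.
set y := x^-1 in cx xE.
have y0 : 0 < y by rewrite invr_gt0.
have yth : y < theta by rewrite /y -[theta]invrK ltf_pV2 ?posrE ?invr_gt0.
have yE : y * sin y = cos y.
  have -> : sin y = x * cos y by rewrite {1}xE /tan mulfVK.
  by rewrite mulrA mulVf // mul1r.
have siny : sin y < sin theta.
  by rewrite ltr_sin // in_itv /=; apply/andP; split; lra.
have cosy : cos theta < cos y.
  by rewrite ltr_cos // in_itv /=; apply/andP; split; lra.
have siny0 : 0 < sin y by apply: sin2_gt0; rewrite y0 /=; lra.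
have : y * sin y < theta * sin theta by rewrite ltr_pM // ltW.
by rewrite yE thE => /(lt_trans cosy); rewrite ltxx.
Qed.

(** The tolerance is half a unit in the last digit of 1.35103. *)
Lemma inv_sqr_approx (R : realType) (t : R) :
  (2581 / 3000) ^+ 2 < t -> t < (154 / 179) ^+ 2 ->
  `|t^-1 - (1351 / 10 ^+ 3 + 3 / 10 ^+ 5)| < 5 / 10 ^+ 6.
Proof.
move=> la lb; have t0 : 0 < t by lra.
have u : t^-1 < (3000 / 2581) ^+ 2.
  by rewrite -[ltLHS]mul1r ltr_pdivrMr //; lra.
have l : (179 / 154) ^+ 2 < t^-1.
  by rewrite -[ltRHS]mul1r ltr_pdivlMr //; lra.
by rewrite ltr_norml; apply/andP; split; lra.
Qed.

Theorem theorem2p2p2 (R : realType) :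
  exists alpha : R,
    [/\ largest_tan_inv_sol alpha,
        `|alpha ^+ 2 - (1351 / 10 ^+ 3 + 3 / 10 ^+ 5)| < 5 / 10 ^+ 6,
        cvgn (fun n : nat => lip_const (grid n n) R)
      & alpha ^+ 2 <= limn (fun n : nat => lip_const (grid n n) R)].
Proof.
have [theta [tha thb thE]] := theta_exists R.
have th0 : 0 < theta by lra.
have th1 : theta < 1 by lra.
exists theta^-1; split.
- exact: largest_tan_inv_sol_theta.
- rewrite [_^-1 ^+ 2]exprVn.
  by apply: inv_sqr_approx; nra.
- exact: lip_const_grid_cvg.
- apply: lip_const_grid_ge => [|n h h0].
    rewrite exprVn -[leRHS]div1r ler_pdivlMr ?exprn_gt0 //; nra.
  by rewrite exprVn; apply: nLip2_ge.
Qed.
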